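(* Assume the standing setup below with $m\ge 3$. Then every downset $S$ of $Q$ with $|S|=n$ such that $S\not\supseteq A\setminus X$ and $S\not\supseteq C\setminus X$ is isomorphic to $B$.
   Context: Standing setup: $\Gamma_n=\{A,B,C\}$ is a set of three pairwise non-isomorphic posets of size $n$, and $Q$ is a witness of $\Gamma_n$ (every downset of $Q$ of size $n$ is isomorphic to one of $A,B,C$, and each occurs). $G_n(Q)$ is the exchange graph: vertices are all downsets of $Q$ of size $n$ (as subsets), adjacent when they differ by exactly one element. A special path is a path $v_0,\ldots,v_r$ ($r\ge2$) in $G_n(Q)$ whose first vertex, internal vertices, and last vertex are isomorphic to three distinct members of $\Gamma_n$ respectively (all internal vertices isomorphic to the same member). Fix a special path of minimal length among all special paths in $G_n(Q)$, labelled so that $v_0\cong A$, $v_1,\ldots,v_{r-1}\cong B$, $v_r\cong C$; by abuse of notation $A:=v_0$ and $C:=v_r$ denote these specific downsets (anchor copies). Assume $Q$ equals the union of the vertices of this path (when $r\ge 3$ this union is $A\cup C$). Let $X=A\cap C$ and $m=|A\setminus X|=|C\setminus X|$. *)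

(* Defs.v *)
From mathcomp Require Import all_boot.
Set Implicit Arguments. Unset Strict Implicit. Unset Printing Implicit Defensive.

Definition partial_order (U : Type) (le : rel U) : Prop :=
  [/\ (forall x, le x x),
      (forall x y, le x y -> le y x -> x = y) &
      (forall x y z, le x y -> le y z -> le x z)].

Definition poset_iso (n : nat) (P P' : rel 'I_n) : Prop :=
  exists g : 'I_n -> 'I_n, bijective g /\ forall i j, P i j = P' (g i) (g j).

Section Q.
Variables (T : finType) (le : rel T).

Definition downset (S : {set T}) : Prop :=
  forall x y, y \in S -> le x y -> x \in S.

Definition iso_to (n : nat) (S : {set T}) (P : rel 'I_n) : Prop :=
  exists f : 'I_n -> T,
    [/\ injective f, [set f i | i : 'I_n] = S &
        forall i j, P i j = le (f i) (f j)].

(* Vertex of the exchange graph G_n(Q): a downset of size n. *)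
Definition gvertex (n : nat) (S : {set T}) : Prop := downset S /\ #|S| = n.

Definition gadj (U V : {set T}) : Prop := #|U :\: V| = 1 /\ #|V :\: U| = 1.

Definition gpath (n : nat) (w : nat -> {set T}) (k : nat) : Prop :=
  [/\ (forall i, i <= k -> gvertex n (w i)),
      (forall i, i < k -> gadj (w i) (w i.+1)) &
      (forall i j, i <= k -> j <= k -> w i = w j -> i = j)].

(* Special path w.r.t. Gamma_n = {G 0, G 1, G 2}, with first/internal/last
   vertices isomorphic to G a, G b, G c respectively. *)
Definition special_path_idx (n : nat) (G : 'I_3 -> rel 'I_n)
    (a b c : 'I_3) (w : nat -> {set T}) (k : nat) : Prop :=
  [/\ [/\ 2 <= k, gpath n w k & [/\ a != b, b != c & a != c]],
      iso_to (w 0) (G a),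
      (forall t, 0 < t < k -> iso_to (w t) (G b)) &
      iso_to (w k) (G c)].

Definition special_path (n : nat) (G : 'I_3 -> rel 'I_n)
    (w : nat -> {set T}) (k : nat) : Prop :=
  exists a b c : 'I_3, special_path_idx G a b c w k.

Definition witness (n : nat) (G : 'I_3 -> rel 'I_n) : Prop :=
  (forall S, gvertex n S -> exists t : 'I_3, iso_to S (G t)) /\
  (forall t : 'I_3, exists S, gvertex n S /\ iso_to S (G t)).
End Q.

(* Main.v *)
Require Import Defs.
From mathcomp Require Import all_boot zify.
From Stdlib Require Import ClassicalEpsilon.
Set Implicit Arguments. Unset Strict Implicit. Unset Printing Implicit Defensive.

(* Colour every vertex of G_n(Q) by the member of Γ_n it is isomorphic to.
   Minimality of the special path forces every path of length < r to use at
   most two colours, so a vertex whose colour differs from those of both ends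
   of an edge lies at distance ≥ r - 1 from it.  Walking along geodesics of
   G_n(Q), which exchange a maximal element of the source for a minimal
   element of the target, this gives |A \ C| = r and A ∩ C ⊆ v_t ⊆ A ∪ C = Q.
   By induction on |(A ∩ C) \ S|, S cannot have the colour of A: the geodesic
   from S to C changes colour along an edge pq; if A ∩ C ⊆ p the distance
   bounds force r = |A \ C| = 3 and a rainbow path of length 2 can be written
   down, otherwise p has a neighbour closer to A ∩ C, coloured like B by
   induction, which again yields a rainbow path.  By symmetry S does not have
   the colour of C either. *)

Section FinsetFacts.
Variable T : finType.
Implicit Types (A C D S U V W Y : {set T}) (x y : T).

Lemma cardsD_sym U W : #|U| = #|W| -> #|U :\: W| = #|W :\: U|.
Proof. by move=> eqUW; rewrite !cardsD eqUW setIC. Qed.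

Lemma cardsD_triangle U V W : #|U :\: W| <= #|U :\: V| + #|V :\: W|.
Proof.
have sub : U :\: W \subset (U :\: V) :|: (V :\: W).
  by apply/subsetP => z; rewrite !inE; case: (z \in U) (z \in V) (z \in W) => [] [] [].
by apply: leq_trans (subset_leq_card sub) _; rewrite -cardsUI leq_addr.
Qed.

Lemma cardsD_setIU Y A C :
  #|Y :\: A| + #|Y :\: C| = #|Y :\: (A :&: C)| + #|Y :\: (A :|: C)|.
Proof. by rewrite -cardsUI setDIr setDUr. Qed.

Lemma cardsD0_eq U W : #|U| = #|W| -> #|U :\: W| = 0 -> U = W.
Proof.
move=> eqUW /eqP; rewrite cards_eq0 setD_eq0 => sUW.
by apply/eqP; rewrite eqEcard sUW eqUW leqnn.
Qed.

Lemma swap_setD x y S : x \notin S -> (x |: (S :\ y)) :\: S = [set x].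
Proof.
move=> xS; apply/setP => z; rewrite !inE.
by case: (eqVneq z x) => [->|] /=; [rewrite (negbTE xS) | case: (z \in S); rewrite ?andbF].
Qed.

Lemma setD_swap x y S : x \notin S -> y \in S -> S :\: (x |: (S :\ y)) = [set y].
Proof.
move=> xS yS; apply/setP => z; rewrite !inE.
case: (eqVneq z y) => [->|_] /=; last by case: (z \in S); rewrite ?orbT ?andbF.
by rewrite yS orbF andbT; apply: contraNneq xS => <-.
Qed.

Lemma card_swap x y S : x \notin S -> y \in S -> #|x |: (S :\ y)| = #|S|.
Proof. by move=> xS yS; rewrite cardsU1 !inE (negbTE xS) andbF (cardsD1 y S) yS. Qed.

Lemma subsetU1_notin D S x : x \notin D -> (D \subset x |: S) = (D \subset S).
Proof.
move=> xD; apply/idP/idP => [/subsetP sub | /subset_trans]; last by apply; exact: subsetU1.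
apply/subsetP => z zD; move: (sub z zD); rewrite !inE => /orP[/eqP zx | //].
by rewrite -zx zD in xD.
Qed.

Lemma setD_set1P U W x : U :\: W = [set x] ->
  [/\ x \in U, x \notin W & forall z, z \in U -> z \notin W -> z = x].
Proof.
move=> UWx; have /setDP[xU xW] : x \in U :\: W by rewrite UWx set11.
by split=> // z zU zW; apply/set1P; rewrite -UWx inE zU zW.
Qed.

Lemma cardsD_lt_cover A C S : (forall x, x \in A :|: C) -> ~~ (A :\: C \subset S) ->
  #|S :\: C| < #|A :\: C|.
Proof.
move=> cover nAS; apply: proper_card; apply/properP; split.
  apply/subsetP => z /setDP[zS zC]; rewrite inE zC.
  by move: (cover z); rewrite inE (negbTE zC) orbF.
by have [z zAC zS] := subsetPn nAS; exists z; rewrite // inE (negbTE zS) andbF.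
Qed.

Lemma ex_minimal (R : rel T) U : partial_order R ->
  U != set0 -> exists2 x, x \in U & forall y, y \in U -> R y x -> y = x.
Proof.
move=> [Rrefl Ranti Rtrans] /set0Pn [x0 Ux0].
pose below x := #|[set y in U | R y x]|.
case: (@arg_minnP _ x0 (mem U) below Ux0) => x Ux xmin.
have {}Ux : x \in U := Ux.
exists x => // y Uy Ryx; apply/eqP/negPn/negP => nyx.
have: [set z in U | R z y] \proper [set z in U | R z x].
  apply/properP; split.
    by apply/subsetP => z; rewrite !inE => /andP[-> Rzy]; exact: Rtrans Rzy Ryx.
  exists x; first by rewrite inE Ux Rrefl.
  by rewrite inE Ux /=; apply: contra nyx => Rxy; rewrite (Ranti _ _ Ryx Rxy).
by move/proper_card; rewrite ltnNge xmin.
Qed.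

End FinsetFacts.

Lemma partial_order_dual (U : Type) (R : rel U) :
  partial_order R -> partial_order (fun x y => R y x).
Proof.
case=> Rrefl Ranti Rtrans; split=> // [x y Ryx Rxy | x y z Ryx Rzy].
- exact: Ranti Rxy Ryx.
- exact: Rtrans Rzy Ryx.
Qed.

Section ExchangeGraph.
Variables (T : finType) (le : rel T) (n : nat).
Hypothesis le_order : partial_order le.
Local Notation vert := (gvertex le n).
Implicit Types (A C D E F S U V W p q : {set T}) (x y : T).

Lemma vert_card S : vert S -> #|S| = n.
Proof. by case. Qed.

Lemma vert_down S : vert S -> downset le S.
Proof. by case. Qed.

Lemma vert_card_eq U V : vert U -> vert V -> #|U| = #|V|.
Proof. by move=> vU vV; rewrite (vert_card vU) (vert_card vV). Qed.

Lemma vert_cardsD_sym U V : vert U -> vert V -> #|U :\: V| = #|V :\: U|.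
Proof. by move=> vU vV; apply/cardsD_sym/vert_card_eq. Qed.

Lemma downsetI U W : downset le U -> downset le W -> downset le (U :&: W).
Proof.
move=> dU dW x y; rewrite !inE => /andP[yU yW] lxy.
by rewrite (dU _ _ yU lxy) (dW _ _ yW lxy).
Qed.

Lemma gadj_sym U W : gadj U W -> gadj W U.
Proof. by case. Qed.

Lemma gadj_card U W : gadj U W -> #|U :\: W| = 1.
Proof. by case. Qed.

Lemma gadj_set1 U W : gadj U W -> exists x, U :\: W = [set x].
Proof. by move/gadj_card/eqP/cards1P. Qed.

Lemma gadj_of_cardsD U W : vert U -> vert W -> U != W -> #|U :\: W| <= 1 -> gadj U W.
Proof.
move=> vU vW neqUW le1; have eqUW := vert_card_eq vU vW.
have UW1 : #|U :\: W| = 1.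
  apply/eqP; rewrite eqn_leq le1 lt0n; apply: contra neqUW => /eqP UW0.
  by rewrite (cardsD0_eq eqUW UW0).
by split; rewrite -?(cardsD_sym eqUW).
Qed.

Lemma gadj_swap S x y : x \notin S -> y \in S -> gadj (x |: (S :\ y)) S.
Proof. by move=> xS yS; split; rewrite ?swap_setD ?setD_swap ?cards1. Qed.

Lemma vert_swap S x y : vert S -> x \notin S -> y \in S ->
  (forall z, z \in S -> le y z -> z = y) ->
  (forall a, a != x -> le a x -> a \in S :\ y) ->
  vert (x |: (S :\ y)).
Proof.
move=> vS xS yS ymax below; split; last by rewrite card_swap // vert_card.
move=> a z; rewrite !inE => /orP[/eqP-> | /andP[zy zS]] az.
  by case: (eqVneq a x) => [-> // | ax]; rewrite -in_setD1 below ?orbT.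
rewrite (vert_down vS zS az) andbT; apply/orP; right.
by apply: contraNneq zy => ay; rewrite (ymax z) // -ay.
Qed.

Lemma vert_swap_between S D E F x y : vert S -> downset le D -> downset le E ->
  downset le F -> S :\: D = [set y] -> E :\: S = [set x] -> x \in F -> y \notin F ->
  vert (x |: (S :\ y)).
Proof.
move=> vS dD dE dF SD ES xF yF.
have /[!inE] /andP[yD yS] : y \in S :\: D by rewrite SD set11.
have /[!inE] /andP[xS xE] : x \in E :\: S by rewrite ES set11.
apply: vert_swap => // [z zS yz | a ax lax].
  apply/eqP; rewrite -in_set1 -SD inE zS andbT.
  by apply: contra yD => zD; apply: dD yz.
have aS : a \in S.
  apply: contraNT ax => aS; rewrite -in_set1 -ES inE aS.
  exact: dE lax.
by rewrite !inE aS andbT; apply: contraNneq yF => <-; apply: dF lax.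
Qed.

Lemma geodesic_step U W : vert U -> vert W -> U != W ->
  exists U', [/\ vert U', gadj U U', U :&: W \subset U', U' \subset U :|: W
              & #|U' :\: W| = #|U :\: W|.-1].
Proof.
move=> vU vW neqUW; have eqUW := vert_card_eq vU vW.
have UW0 : U :\: W != set0.
  by rewrite -card_gt0 lt0n; apply: contra neqUW => /eqP /(cardsD0_eq eqUW) ->.
have WU0 : W :\: U != set0 by rewrite -card_gt0 -(cardsD_sym eqUW) card_gt0.
have [x /[!inE] /andP[xU xW] xmin] := ex_minimal le_order WU0.
have [y /[!inE] /andP[yW yU] ymax] := ex_minimal (partial_order_dual le_order) UW0.
exists (x |: (U :\ y)); split.
- apply: vert_swap => // [z zU yz | a ax lax].
    by apply: ymax => //; rewrite inE zU andbT; apply: contra yW => /(vert_down vW); apply.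
  have aW : a \in W := vert_down vW xW lax.
  have aU : a \in U by apply: contraNT ax => aU; rewrite (xmin a) // inE aU.
  by rewrite !inE aU andbT; apply: contraNneq yW => <-.
- exact: gadj_sym (gadj_swap xU yU).
- by apply/subsetP => z /setIP[zU zW]; rewrite !inE zU andbT; apply/orP; right;
    apply: contraTneq zW => ->.
- by apply/subsetP => z; rewrite !inE => /orP[/eqP-> | /andP[_ ->]]; rewrite ?xW ?orbT.
- have -> : (x |: (U :\ y)) :\: W = (U :\: W) :\ y.
    apply/setP => z; rewrite !inE; case: (eqVneq z x) => [->|_]; first by rewrite xW !andbF.
    by rewrite /= andbCA.
  by rewrite (cardsD1 y (U :\: W)) !inE yU yW.
Qed.

Lemma geodesic U W : vert U -> vert W -> exists w : nat -> {set T},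
  [/\ w 0 = U, w #|U :\: W| = W, gpath le n w #|U :\: W|,
     forall i, i <= #|U :\: W| ->
       [/\ U :&: W \subset w i, w i \subset U :|: W & #|w i :\: W| = #|U :\: W| - i]
   & forall i, i < #|U :\: W| -> w i :&: W \subset w i.+1].
Proof.
move=> vU vW; move eqd: #|U :\: W| => d; elim: d U vU eqd => [|d IH] U vU eqd.
  have -> : U = W by apply: cardsD0_eq; rewrite ?eqd ?vert_card.
  exists (fun=> W); split=> // [|i]; last by rewrite setIid subsetUr setDv cards0.
  by split=> // i j; rewrite !leqn0 => /eqP-> /eqP->.
have neqUW : U != W by apply/eqP=> eqUW; move: eqd; rewrite eqUW setDv cards0.
have [U' [vU' adjUU' UWU' U'UW]] := geodesic_step vU vW neqUW; rewrite eqd /= => eqd'.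
have [w' [w'0 w'd [vw' adjw' _] w'i w'step]] := IH U' vU' eqd'.
pose w i := if i is i'.+1 then w' i' else U.
have cardw i : i <= d.+1 -> #|w i :\: W| = d.+1 - i.
  by case: i => [|i] /= hi; [rewrite eqd | case: (w'i i hi)].
exists w; split=> //.
- split=> [[|i] hi | [|i] hi | i j hi hj eqij] //=; [exact: vw' | by rewrite w'0 | exact: adjw' |].
  by move: (cardw i hi) (cardw j hj); rewrite eqij => -> /eqP; rewrite eqn_sub2lE //; move/eqP.
- case=> [|i] hi; first by rewrite subsetIl subsetUl cardw.
  have [sU'W sw'U' cw'] := w'i i hi; split; rewrite ?cw' //.
  + by apply: subset_trans sU'W; rewrite subsetI subsetIr UWU'.
  + by apply: subset_trans sw'U' _; rewrite subUset U'UW subsetUr.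
- by case=> [|i] hi; [rewrite /= w'0 | exact: w'step].
Qed.

Lemma gpath_cardsD w k i j : gpath le n w k -> i <= j -> j <= k ->
  #|w i :\: w j| <= j - i.
Proof.
move=> [_ adjw _] ij jk; elim: j ij jk => [|j IH] ij jk.
  by move: ij; rewrite leqn0 => /eqP->; rewrite setDv cards0.
case: (eqVneq i j.+1) => [-> | neq]; first by rewrite setDv cards0.
have ij' : i <= j by rewrite -ltnS ltn_neqAle neq.
apply: leq_trans (cardsD_triangle _ (w j) _) _.
by rewrite (gadj_card (adjw j jk)) addn1 subSn // ltnS IH // ltnW.
Qed.

Lemma geodesic_interval U V W : vert U -> vert V -> vert W ->
  #|U :\: V| + #|V :\: W| <= #|U :\: W| -> U :&: W \subset V /\ V \subset U :|: W.
Proof.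
move=> vU vV vW short.
have := cardsD_setIU V U W; rewrite -(vert_cardsD_sym vU vV).
have cXV := cardsD (U :&: W) V; have cVX := cardsD V (U :&: W).
have cUW := cardsD U W.
have sXV : #|U :&: W :&: V| <= #|U :&: W| by apply/subset_leq_card/subsetIl.
have sX : #|U :&: W| <= #|U| by apply/subset_leq_card/subsetIl.
rewrite [V :&: _]setIC in cVX; rewrite (vert_card vU) in cUW sX.
rewrite (vert_card vV) in cVX => eq.
have XV0 : #|U :&: W :\: V| == 0 by apply/eqP; lia.
have out0 : #|V :\: (U :|: W)| == 0 by apply/eqP; lia.
by move: XV0 out0; rewrite !cards_eq0 !setD_eq0.
Qed.

Lemma gpath_shift w k s t : gpath le n w k -> s <= t -> t <= k ->
  gpath le n (fun i => w (s + i)) (t - s).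
Proof.
move=> [vw adjw injw] st tk; split=> [i hi | i hi | i j hi hj /injw].
- by apply: vw; lia.
- by rewrite addnS; apply: adjw; lia.
- by move=> eqw; apply/eqP; rewrite -(eqn_add2l s); apply/eqP/eqw; lia.
Qed.

Lemma gpath_rcons w k q : gpath le n w k -> vert q -> gadj (w k) q ->
  (forall i, i <= k -> w i != q) ->
  gpath le n (fun i => if i <= k then w i else q) k.+1.
Proof.
move=> [vw adjw injw] vq adjq neqq; split=> [i hi | i hi | i j hi hj].
- by case: ifP => // /vw.
- case: (ltngtP i k) => [ik | ki | ->]; [exact: adjw | | exact: adjq].
  by rewrite ltnS leqNgt ki in hi.
- case: ifP => ik; case: ifP => jk; [exact: injw | | |]; last by lia.
  + by move=> eq; move: (neqq i ik); rewrite eq eqxx.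
  + by move=> eq; move: (neqq j jk); rewrite eq eqxx.
Qed.

Lemma ex_maximal_upset S D : D \subset S -> D != set0 ->
  (forall y z, y \in D -> z \in S -> le y z -> z \in D) ->
  exists2 y, y \in D & forall z, z \in S -> le y z -> z = y.
Proof.
move=> DS D0 upD; have [y Dy ymax] := ex_minimal (partial_order_dual le_order) D0.
by exists y => // z Sz yz; apply: ymax => //; apply: upD yz.
Qed.

Lemma subsetD1_notin D p y : ~~ (D \subset p) -> ~~ (D \subset p :\ y).
Proof. by apply: contra => /subset_trans; apply; apply: subD1set. Qed.

Lemma ex_removable_top A C p : vert A -> vert C -> (forall x, x \in A :|: C) -> vert p ->
  ~~ (A :\: C \subset p) ->
  exists y, [/\ y \in p, y \notin A :&: C, forall z, z \in p -> le y z -> z = y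
            & ~~ (C :\: A \subset p :\ y)].
Proof.
move=> vA vC cover vp nAp.
have dA := vert_down vA; have dX := downsetI dA (vert_down vC).
case: (boolP (C :\: A \subset p)) => [sCp | nCp].
- have CA0 : C :\: A != set0.
    rewrite -card_gt0 -(vert_cardsD_sym vA vC) card_gt0.
    by apply: contraNneq nAp => ->; rewrite sub0set.
  have [y yCA ymax] : exists2 y, y \in C :\: A & forall z, z \in p -> le y z -> z = y.
    apply: ex_maximal_upset => // y z; rewrite !inE => /andP[yA _] _ yz.
    have zA : z \notin A by apply: contra yA => zA; apply: dA zA yz.
    by rewrite zA; move: (cover z); rewrite inE (negbTE zA).
  exists y; split=> //; first exact: subsetP sCp y yCA.
    by move: yCA; rewrite !inE => /andP[/negbTE-> _].
  by apply/subsetPn; exists y; rewrite // !inE eqxx.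
- have pX0 : p :\: (A :&: C) != set0.
    rewrite -card_gt0 cardsD (vert_card vp) subn_gt0 -(vert_card vA).
    apply: leq_ltn_trans (subset_leq_card (subsetIr p _)) _.
    apply: proper_card; rewrite properEneq subsetIl andbT.
    apply: contraNneq nAp => eqXA; apply/subsetP => z.
    by rewrite -eqXA !inE => /andP[/negbTE zC /andP[_]]; rewrite zC.
  have [y /setDP[yp yX] ymax] : exists2 y, y \in p :\: (A :&: C) &
      forall z, z \in p -> le y z -> z = y.
    apply: ex_maximal_upset; rewrite ?subsetDl // => y z /setDP[_ yX] zp yz.
    by rewrite in_setD zp andbT; apply: contra yX => zX; apply: dX zX yz.
  by exists y; split; rewrite ?subsetD1_notin.
Qed.

Lemma step_into_meet A C p : vert A -> vert C -> (forall x, x \in A :|: C) -> vert p ->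
  ~~ (A :\: C \subset p) -> ~~ (A :&: C \subset p) ->
  exists b, [/\ vert b, gadj b p, #|(A :&: C) :\: b| < #|(A :&: C) :\: p|,
               ~~ (A :\: C \subset b) & ~~ (C :\: A \subset b)].
Proof.
move=> vA vC cover vp nAp nXp.
have dX := downsetI (vert_down vA) (vert_down vC).
have Xp0 : (A :&: C) :\: p != set0 by rewrite setD_eq0.
have [x xXp xmin] := ex_minimal le_order Xp0.
move: (xXp); rewrite !inE => /andP[xp /andP[xA xC]].
have [y [yp yX ymax nCy]] := ex_removable_top vA vC cover vp nAp.
exists (x |: (p :\ y)); split.
- apply: vert_swap => // a ax ax'.
  have aX : a \in A :&: C by apply: dX ax'; rewrite inE xA.
  have ap : a \in p by apply: contraT => ap; move: ax; rewrite (xmin a) ?eqxx // in_setD ap.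
  by rewrite !inE ap andbT; apply: contraNneq yX => <-.
- exact: gadj_swap.
- apply: leq_ltn_trans (proper_card (properD1 xXp)).
  apply/subset_leq_card/subsetP => z; rewrite !inE negb_or negb_and negbK.
  case/and3P=> /andP[zx /orP[/eqP zy | zp]] zA zC; last by rewrite zx zp zA zC.
  by move: yX; rewrite -zy in_setI zA zC.
- by rewrite subsetU1_notin ?inE ?xC // subsetD1_notin.
- by rewrite subsetU1_notin // inE xA.
Qed.

End ExchangeGraph.

Definition distinct3 (X : eqType) (a b c : X) := [&& a != b, b != c & a != c].

Lemma distinct3C12 (X : eqType) (a b c : X) : distinct3 a b c = distinct3 b a c.
Proof. by rewrite /distinct3 [b == a]eq_sym; case: (a == b) (a == c) (b == c) => [] [] []. Qed.

Lemma distinct3C23 (X : eqType) (a b c : X) : distinct3 a b c = distinct3 a c b.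
Proof. by rewrite /distinct3 [c == b]eq_sym; case: (a == b) (a == c) (b == c) => [] [] []. Qed.

Lemma distinct3_rev (X : eqType) (a b c : X) : distinct3 a b c = distinct3 c b a.
Proof.
rewrite /distinct3 ![c == _]eq_sym [b == a]eq_sym.
by case: (a == b) (a == c) (b == c) => [] [] [].
Qed.

Lemma ord3_third (a b c t : 'I_3) : distinct3 a b c -> t != a -> t != c -> t = b.
Proof.
rewrite /distinct3 -!val_eqE /= => /and3P[ab bc ac] ta tc; apply/val_inj/eqP => /=.
by move: (ltn_ord a) (ltn_ord b) (ltn_ord c) (ltn_ord t) ab bc ac ta tc; lia.
Qed.

Lemma exists_switch (P : pred nat) k : P 0 -> ~~ P k -> exists2 i, i < k & P i && ~~ P i.+1.
Proof.
elim: k => [-> // | k IH] P0 Pk; case: (boolP (P k)) => [Pk' | /(IH P0) [i ik Pi]].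
  by exists k; rewrite ?Pk' ?Pk.
by exists i => //; apply: ltnW.
Qed.

Lemma rainbow_window (c : nat -> 'I_3) x y z : x < y -> y < z ->
  distinct3 (c x) (c y) (c z) ->
  exists s t, [/\ x <= s, s.+1 < t, t <= z, distinct3 (c s) (c s.+1) (c t)
                & forall u, s < u < t -> c u = c s.+1].
Proof.
(* Shrink to a shortest interval with three colours: its end colours occur
   only at its ends. *)
move: {2}(z - x) (leqnn (z - x)) => N; elim: N x y z => [|N IH] x y z hN xy yz d3; first by lia.
have [/existsP [[u uz] /= /andP[xu cu]] | none] :=
  boolP [exists u : 'I_z, (x < u) && ((c u == c x) || (c u == c z))].
- have shrink x' y' z' : x <= x' -> z' <= z -> z' - x' <= N -> x' < y' -> y' < z' ->
      distinct3 (c x') (c y') (c z') -> exists s t, [/\ x <= s, s.+1 < t, t <= z,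
        distinct3 (c s) (c s.+1) (c t) & forall u, s < u < t -> c u = c s.+1].
    move=> xx' z'z hN' x'y' y'z' /(IH x' y' z' hN' x'y' y'z') [s [t [x's st tz' ds cst]]].
    by exists s, t; split=> //; [apply: leq_trans x's | apply: leq_trans z'z].
  have : u != y.
    by apply: contraTneq cu => ->; case/and3P: d3 => cxy cyz _; rewrite negb_or eq_sym cxy cyz.
  case: (ltngtP u y) => // [uy | yu] _; case/orP: cu => /eqP cu.
  + by apply: (shrink u y z); rewrite ?cu //; lia.
  + by apply: (shrink x u y); rewrite ?cu; [lia .. | rewrite -distinct3C23].
  + by apply: (shrink y u z); rewrite ?cu; [lia .. | rewrite -distinct3C12].
  + by apply: (shrink x y u); rewrite ?cu //; lia.
- have inner u : x < u < z -> c u = c y.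
    case/andP=> xu uz; apply: (ord3_third (t := c u) d3).
    + by apply: contraNneq none => cu; apply/existsP; exists (Ordinal uz); rewrite xu cu eqxx.
    + by apply: contraNneq none => cu; apply/existsP; exists (Ordinal uz); rewrite xu cu eqxx orbT.
  have cx1 : c x.+1 = c y by apply: inner; lia.
  exists x, z; split=> //; [lia | by rewrite cx1 | by move=> u /inner ->].
Qed.

Section MinimalSpecialPath.
Variables (T : finType) (le : rel T) (n : nat) (G : 'I_3 -> rel 'I_n) (r : nat).
Hypothesis le_order : partial_order le.
Hypothesis G_distinct : forall s t : 'I_3, s != t -> ~ poset_iso (G s) (G t).
Hypothesis G_witness : witness le G.
Hypothesis r_min : forall (w : nat -> {set T}) (k : nat), special_path le G w k -> r <= k.
Local Notation vert := (gvertex le n).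
Implicit Types (A C S U V W Y Z b p q : {set T}) (w : nat -> {set T}).

(* Arbitrary on sets that are isomorphic to no [G t]. *)
Definition col S : 'I_3 := epsilon (inhabits ord0) (fun t => iso_to le S (G t)).

Lemma iso_to_uniq S s t : iso_to le S (G s) -> iso_to le S (G t) -> s = t.
Proof.
move=> [f [finj fS fG]] [g [ginj gS gG]].
apply/eqP/negPn/negP => /G_distinct; apply.
have gf i : exists j, g j = f i.
  have : f i \in S by rewrite -fS imset_f.
  by rewrite -gS => /imsetP [j _ ->]; exists j.
pose h i := odflt i [pick j | g j == f i].
have ghf i : g (h i) = f i.
  rewrite /h; case: pickP => [j /eqP // | none].
  by have [j gj] := gf i; move: (none j); rewrite gj eqxx.
exists h; split; last by move=> i j; rewrite fG gG !ghf.
by apply: injF_bij => i j hij; apply: finj; rewrite -!ghf hij.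
Qed.

Lemma col_spec S : (exists t, iso_to le S (G t)) -> iso_to le S (G (col S)).
Proof. exact: epsilon_spec. Qed.

Lemma col_eq S t : iso_to le S (G t) -> col S = t.
Proof. by move=> St; apply: (iso_to_uniq _ St); apply: col_spec; exists t. Qed.

Lemma colP S : vert S -> iso_to le S (G (col S)).
Proof. by move=> /G_witness.1 /col_spec. Qed.

Lemma special_path_len w k : gpath le n w k -> 2 <= k ->
  distinct3 (col (w 0)) (col (w 1)) (col (w k)) ->
  (forall t, 0 < t < k -> col (w t) = col (w 1)) -> r <= k.
Proof.
move=> wpath k2 /and3P[c01 c1k c0k] inner; have [vw _ _] := wpath.
apply: (r_min (w := w)); exists (col (w 0)), (col (w 1)), (col (w k)); split=> //.
- exact: colP (vw 0 _).
- by move=> t t0k; rewrite -(inner t t0k); apply: colP; apply: vw; case/andP: t0k => _ /ltnW.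
- exact: colP (vw k _).
Qed.

Lemma rainbow_walk U V W : vert U -> vert V -> vert W ->
  #|U :\: V| <= 1 -> #|V :\: W| <= 1 -> distinct3 (col U) (col V) (col W) -> r <= 2.
Proof.
move=> vU vV vW UV VW d3; have /and3P[cUV cVW cUW] := d3.
have neq S S' : col S != col S' -> S != S' by apply: contraNneq => ->.
pose w i := if i == 0 then U else if i == 1 then V else W.
apply: (@special_path_len w 2) => //; last by case=> [|[|[]]].
split=> [[|[|[|i]]] // | [|[|i]] // _ | ].
- exact: gadj_of_cardsD vU vV (neq _ _ cUV) UV.
- exact: gadj_of_cardsD vV vW (neq _ _ cVW) VW.
- move=> i j hi hj /(congr1 col) /eqP; apply: contraTeq => /eqP neqij; rewrite /w.
  by case: i j hi hj neqij => [|[|[|i]]] [|[|[|j]]] //= _ _ _; rewrite // eq_sym.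
Qed.

Lemma short_path_no_rainbow w k x y z : gpath le n w k -> k < r ->
  x < y -> y < z -> z <= k -> ~~ distinct3 (col (w x)) (col (w y)) (col (w z)).
Proof.
move=> wpath kr xy yz zk; apply/negP.
case/(rainbow_window (c := fun i => col (w i)) xy yz) => [s [t [xs st tz d3 inner]]].
have shifted := gpath_shift wpath (ltnW (ltnW st)) (leq_trans tz zk).
have : r <= t - s.
  apply: special_path_len shifted _ _ _; first by lia.
    by rewrite addn0 addn1 subnKC // ltnW // ltnW.
  by move=> i /andP[i0 ist]; rewrite addn1 inner //; lia.
by lia.
Qed.

Lemma short_path_switch w k : gpath le n w k -> k < r -> col (w 0) != col (w k) ->
  exists2 i, i < k & col (w i) = col (w 0) /\ col (w i.+1) = col (w k).
Proof.
move=> wpath kr c0k.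
rewrite eq_sym in c0k.
have [i ik /andP[/eqP ci ci1]] := exists_switch (P := fun i => col (w i) == col (w 0)) (eqxx _) c0k.
exists i => //; split=> //; case: (ltngtP i.+1 k) => [ik1 | | -> //]; last by rewrite ltnNge ik.
apply/eqP; apply: contraNT (short_path_no_rainbow wpath kr (ltn0Sn i) ik1 (leqnn k)) => c1k.
by rewrite /distinct3 eq_sym ci1 c1k eq_sym c0k.
Qed.

Lemma rainbow_edge_far b p q : vert b -> vert p -> vert q -> gadj p q ->
  distinct3 (col b) (col p) (col q) -> r.-1 <= #|b :\: p|.
Proof.
move=> vb vp vq pq d3; have /and3P[cbp cpq cbq] := d3.
have [w [w0 wd wpath _ _]] := geodesic le_order vb vp.
move: wd wpath; set d := #|b :\: p| => wd wpath.
rewrite leqNgt; apply/negP => dr; have {}dr : d.+1 < r by lia.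
have d0 : 0 < d by rewrite lt0n; apply: contraNneq cbp => d0; rewrite -w0 -wd d0.
have qw i : i <= d -> w i != q.
  move=> id; apply/eqP => wiq.
  case: (posnP i) => [i0 | i0]; first by move: cbq; rewrite -w0 -wiq i0 eqxx.
  case: (ltngtP i d) => [id' | di | id']; last by move: cpq; rewrite -wd -wiq id' eqxx.
    have := short_path_no_rainbow wpath (ltnW dr) i0 id' (leqnn d).
    by rewrite w0 wd wiq -distinct3C23 d3.
  by rewrite ltnNge id in di.
have wq : gadj (w d) q by rewrite wd.
have := short_path_no_rainbow (gpath_rcons wpath vq wq qw) dr d0 (ltnSn d) (leqnn _).
by rewrite leq0n leqnn ltnn w0 wd d3.
Qed.

Lemma rainbow_edge_far_adj A a p q : vert A -> vert a -> vert p -> vert q ->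
  gadj a A -> gadj p q -> distinct3 (col a) (col p) (col q) -> r.-2 <= #|A :\: p|.
Proof.
move=> vA va vp vq aA pq /(rainbow_edge_far va vp vq pq).
by have := cardsD_triangle a A p; rewrite (gadj_card aA); lia.
Qed.

Lemma col_pinned Z U U' Y P : 2 < r -> vert Z -> vert U -> vert U' -> vert Y -> vert P ->
  #|Z :\: U| <= 1 -> #|Z :\: U'| <= 1 -> gadj U Y -> gadj U' P ->
  col U' = col U -> distinct3 (col Y) (col U) (col P) -> col Z = col U.
Proof.
move=> r3 vZ vU vU' vY vP ZU ZU' UY U'P cU' d3.
have noF : ~ r <= 2 by apply/negP; rewrite -ltnNge.
apply: (ord3_third (t := col Z) d3); apply/eqP => cZ; apply: noF.
- by apply: (rainbow_walk vZ vU' vP ZU' (eq_leq (gadj_card U'P))); rewrite cZ cU'.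
- by apply: (rainbow_walk vZ vU vY ZU (eq_leq (gadj_card UY))); rewrite cZ -distinct3_rev.
Qed.

(* [A] and [C] stand for the ends of the minimal special path, [A'] and [C']
   for their neighbours on it. *)
Record ends A C A' C' : Prop := Ends {
  ends_vert : [/\ vert A, vert C, vert A' & vert C'];
  ends_adj : gadj A' A /\ gadj C' C;
  ends_col : distinct3 (col A) (col A') (col C);
  ends_colC' : col C' = col A' }.

Lemma ends_sym A C A' C' : ends A C A' C' -> ends C A C' A'.
Proof.
case=> [[vA vC vA' vC'] [A'A C'C] d3 cC']; split=> //.
by rewrite cC' distinct3_rev.
Qed.

Lemma switch_edge_bound A C A' C' p q : ends A C A' C' -> vert p -> vert q -> gadj p q ->
  col p = col A -> col q = col C -> A :&: C \subset p -> p \subset A :|: C ->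
  [/\ r.-2 <= #|p :\: A|, r.-2 <= #|q :\: C| & #|p :\: A| + #|p :\: C| = #|A :\: C|].
Proof.
case=> [[vA vC vA' vC'] [A'A C'C] d3 cC'] vp vq pq cp cq Xp pAC.
split.
- rewrite -(vert_cardsD_sym vA vp); apply: rainbow_edge_far_adj vA vA' vp vq A'A pq _.
  by rewrite cp cq -distinct3C12.
- rewrite -(vert_cardsD_sym vC vq).
  apply: rainbow_edge_far_adj vC vC' vq vp C'C (gadj_sym pq) _.
  by rewrite cp cq cC' distinct3C12 distinct3_rev.
- have /eqP out : p :\: (A :|: C) == set0 by rewrite setD_eq0.
  rewrite cardsD_setIU out cards0 addn0 (cardsDS Xp) cardsD.
  by rewrite (vert_card_eq vp vA).
Qed.

Lemma ends_card_ge A C A' C' : ends A C A' C' -> 2 < #|A :\: C| -> r <= #|A :\: C|.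
Proof.
move=> E m3; have [[vA vC _ _] _ d3 _] := E.
rewrite leqNgt; apply/negP => mr.
have [w [w0 wd wpath wi _]] := geodesic le_order vA vC.
have c0m : col (w 0) != col (w #|A :\: C|) by rewrite w0 wd; case/and3P: d3.
have [i im] := short_path_switch wpath mr c0m; rewrite w0 wd => -[ci ci1].
have [vw adjw _] := wpath.
have [Xp pAC pC] := wi i (ltnW im); have [_ _ qC] := wi i.+1 im.
have [] := switch_edge_bound E (vw i (ltnW im)) (vw i.+1 im) (adjw i im) ci ci1 Xp pAC.
by rewrite pC qC; lia.
Qed.

Record frame A C A' C' : Prop := Frame {
  frame_ends : ends A C A' C';
  frame_meet : A :&: C \subset A' :&: C';
  frame_adj3 : r = 3 -> gadj A' C';
  frame_cover : forall x, x \in A :|: C;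
  frame_card : #|A :\: C| = r;
  frame_r3 : 2 < r }.

Lemma frame_sym A C A' C' : frame A C A' C' -> frame C A C' A'.
Proof.
case=> E meet adj3 cover card r3; split=> //.
- exact: ends_sym.
- by rewrite setIC [C' :&: _]setIC.
- by move/adj3/gadj_sym.
- by move=> x; rewrite setUC.
- have [[vA vC _ _] _ _ _] := E.
  by rewrite -(vert_cardsD_sym vA vC).
Qed.

Section Frame.
Variables A C A' C' : {set T}.
Hypothesis F : frame A C A' C'.

Lemma frame_swap_points_neq a c : r = 3 -> A :\: A' = [set a] -> C' :\: C = [set c] -> a != c.
Proof.
move=> r3 /setD_set1P[aA aA' _] /setD_set1P[cC' _ _]; apply/eqP => eac.
rewrite -eac in cC'.
have [[vA vC vA' vC'] [A'A C'C] _ _] := frame_ends F.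
have [k1 /setD_set1P[_ _ k1uniq]] := gadj_set1 A'A.
have [c3 /setD_set1P[_ _ c3uniq]] := gadj_set1 (gadj_sym C'C).
have : 0 < #|(C :\: A) :\: [set c3; k1]|.
  have : #|(C :\: A) :&: [set c3; k1]| <= 2.
    by apply: leq_trans (subset_leq_card (subsetIr _ _)) _; rewrite cards2 ltnS leq_b1.
  by rewrite cardsD -(vert_cardsD_sym vA vC) (frame_card F) r3; lia.
case/card_gt0P=> e /setDP[/setDP[eC eA]]; rewrite !inE negb_or => /andP[ec3 ek1].
have eC' : e \in C' by apply: contraT => eC'; rewrite (c3uniq e eC eC') eqxx in ec3.
have eA' : e \notin A' by apply: contra ek1 => eA'; rewrite (k1uniq e eA' eA).
have : [set a; e] \subset C' :\: A' by rewrite subUset !sub1set !inE aA' eA' eC' cC'.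
move/subset_leq_card; rewrite cards2 (gadj_card (gadj_sym (frame_adj3 F r3))).
have ae : a != e by apply: contraNneq eA => <-.
by rewrite ae.
Qed.

Lemma frame_left_swap p q a1 k : vert p -> vert q -> gadj p q ->
  col p = col A -> col q = col C -> A :\: A' = [set a1] -> p :\: A = [set k] ->
  k \in C -> a1 \notin C ->
  [/\ vert (k |: (A :\ a1)), col (k |: (A :\ a1)) = col A & #|A' :\: (k |: (A :\ a1))| <= 1].
Proof.
move=> vp vq pq cp cq Aa1 pk kC a1C.
have [[vA vC vA' _] [A'A _] d3 _] := frame_ends F.
have [[_ a1A' _] [kp kA _]] := (setD_set1P Aa1, setD_set1P pk).
have vY := vert_swap_between vA (vert_down vA') (vert_down vp) (vert_down vC) Aa1 pk kC a1C.
split=> //.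
- apply: (col_pinned (frame_r3 F) vY vA vp vA' vq _ _ (gadj_sym A'A) pq cp).
  + by rewrite swap_setD // cards1.
  + have Ap : #|A :\: p| = 1.
      by rewrite (vert_cardsD_sym vA vp) pk cards1.
    rewrite -Ap; apply/subset_leq_card/subsetP => z; rewrite !inE.
    case/andP=> zp /orP[/eqP zk | /andP[_ ->]]; last by rewrite zp.
    by rewrite zk kp in zp.
  + by rewrite cq distinct3C12.
- rewrite -(gadj_card A'A); apply: subset_leq_card; apply/subsetP => z; rewrite !inE.
  case/andP=> /norP[_ /nandP[/negPn/eqP za1 | ->]] zA' //.
  by rewrite -za1 zA' in a1A'.
Qed.

Lemma frame_right_swap p q c a3 : vert p -> vert q -> gadj p q ->
  col p = col A -> col q = col C -> C :\: q = [set c] -> C' :\: C = [set a3] ->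
  a3 \in A -> c \notin A -> vert (a3 |: (C :\ c)) /\ col (a3 |: (C :\ c)) = col C.
Proof.
move=> vp vq pq cp cq Cc C'a3 a3A cA.
have [[vA vC _ vC'] [_ C'C] d3 cC'] := frame_ends F.
have [[_ _ cuniq] [_ a3C _]] := (setD_set1P Cc, setD_set1P C'a3).
have vZ := vert_swap_between vC (vert_down vq) (vert_down vC') (vert_down vA) Cc C'a3 a3A cA.
split=> //; apply: (col_pinned (frame_r3 F) vZ vC vq vC' vp _ _ (gadj_sym C'C) (gadj_sym pq) cq).
- by rewrite swap_setD // cards1.
- rewrite -(cards1 a3); apply/subset_leq_card/subsetP => z; rewrite !inE.
  case/andP=> zq /orP[// | /andP[zc zC]].
  by move: zc; rewrite (cuniq z zC zq) eqxx.
- by rewrite cp cC' -distinct3_rev distinct3C23.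
Qed.

Lemma frame_tight_switch_absurd p q : r = 3 -> vert p -> vert q -> gadj p q ->
  col p = col A -> col q = col C -> A :&: C \subset p -> p :&: C \subset q ->
  #|p :\: A| = 1 -> #|q :\: C| = 1 -> False.
Proof.
move=> r3 vp vq pq cp cq Xp pCq pA1 qC1.
have [[_ vC vA' _] [A'A C'C] d3 _] := frame_ends F.
have cover := frame_cover F; have /subsetIP[XA' _] := frame_meet F.
have [a1 Aa1] := gadj_set1 (gadj_sym A'A); have [a3 C'a3] := gadj_set1 C'C.
have [k pk] : exists k, p :\: A = [set k] by apply/cards1P; rewrite pA1.
have [c Cc] : exists c, C :\: q = [set c].
  by apply/cards1P; rewrite (vert_cardsD_sym vC vq) qC1.
have a13 := frame_swap_points_neq r3 Aa1 C'a3.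
move: (Aa1) (C'a3) (pk) (Cc) => /setD_set1P[a1A a1A' _] /setD_set1P[_ a3C _]
  /setD_set1P[kp kA _] /setD_set1P[cC cnq _].
have a1C : a1 \notin C by apply: contra a1A' => a1C; apply: (subsetP XA'); rewrite inE a1A.
have kC : k \in C by move: (cover k); rewrite inE (negbTE kA).
have a3A : a3 \in A by move: (cover a3); rewrite inE (negbTE a3C) orbF.
have kq : k \in q by apply: (subsetP pCq); rewrite inE kp.
have cA : c \notin A.
  apply: contra cnq => cA; apply: (subsetP pCq); rewrite inE cC andbT.
  by apply: (subsetP Xp); rewrite inE cA.
have [vY cY A'Y] := frame_left_swap vp vq pq cp cq Aa1 pk kC a1C.
have [vZ cZ] := frame_right_swap vp vq pq cp cq Cc C'a3 a3A cA.
have YZ : #|(k |: (A :\ a1)) :\: (a3 |: (C :\ c))| <= 1.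
  have sub : [set a1; a3] \subset A :\: C by rewrite subUset !sub1set !inE a1A a1C a3A a3C.
  have : #|(A :\: C) :\: [set a1; a3]| = 1 by rewrite cardsDS // (frame_card F) cards2 a13 r3.
  move <-; apply: subset_leq_card; apply/subsetP => z; rewrite !inE.
  case/andP=> /norP[za3 /nandP[zc | zC]] /orP[/eqP zk | /andP[za1 zA]].
  - by move: cnq; rewrite -(eqP (negPn zc)) zk kq.
  - by move: cA; rewrite -(eqP (negPn zc)) zA.
  - by rewrite zk kC in zC.
  - by rewrite negb_or za1 za3 zC zA.
have : r <= 2 by apply: (rainbow_walk vA' vY vZ A'Y YZ); rewrite cY cZ -distinct3C12.
by rewrite r3.
Qed.

Lemma frame_col_neq S : vert S -> ~~ (A :\: C \subset S) -> ~~ (C :\: A \subset S) ->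
  (forall Y, vert Y -> #|(A :&: C) :\: Y| < #|(A :&: C) :\: S| ->
     ~~ (A :\: C \subset Y) -> ~~ (C :\: A \subset Y) -> col Y = col A') ->
  col S != col A.
Proof.
move=> vS nAS nCS IH; apply/eqP => cS.
have [[vA vC _ _] _ d3 _] := frame_ends F.
have cover := frame_cover F.
have [w [w0 wd wpath wi wstep]] := geodesic le_order vS vC.
move: wd wpath wi wstep; set d := #|S :\: C| => wd wpath wi wstep.
have dr : d < r by rewrite -(frame_card F) cardsD_lt_cover.
have c0d : col (w 0) != col (w d) by rewrite w0 wd cS; case/and3P: d3.
have [i id] := short_path_switch wpath dr c0d; rewrite w0 wd cS => -[cp cq].
have [vw adjw _] := wpath.
have [SCp pSC pC] := wi i (ltnW id); have [_ _ qC] := wi i.+1 id.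
move: (vw i (ltnW id)) (vw i.+1 id) (adjw i id) (wstep i id) SCp pSC pC qC cp cq.
set p := w i; set q := w i.+1 => vp vq pq pCq SCp pSC pC qC cp cq.
have nAp : ~~ (A :\: C \subset p).
  apply: contra nAS => /subset_trans /(_ pSC) ACSC; apply/subsetP => z zAC.
  have := subsetP ACSC z zAC; case/setDP: zAC => _ zC.
  by rewrite inE (negbTE zC) orbF.
have [Xp | nXp] := boolP (A :&: C \subset p).
  have pAC : p \subset A :|: C by apply/subsetP => z _; apply: cover.
  have [pA qC' sum] := switch_edge_bound (frame_ends F) vp vq pq cp cq Xp pAC.
  have r3 := frame_r3 F; rewrite (frame_card F) pC in sum.
  by apply: (frame_tight_switch_absurd _ vp vq pq cp cq Xp pCq); lia.
have [b [vb bp Xb nAb nCb]] := step_into_meet le_order vA vC cover vp nAp nXp.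
have XpS : #|(A :&: C) :\: p| <= #|(A :&: C) :\: S|.
  apply/subset_leq_card/subsetP => z; rewrite !inE => /andP[zp zX]; rewrite zX andbT.
  by apply: contra zp => zS; apply: (subsetP SCp); rewrite inE zS; case/andP: zX.
have cb := IH b vb (leq_trans Xb XpS) nAb nCb.
have : r <= 2.
  apply: (rainbow_walk vb vp vq (eq_leq (gadj_card bp)) (eq_leq (gadj_card pq))).
  by rewrite cb cp cq -distinct3C12.
by rewrite leqNgt (frame_r3 F).
Qed.

End Frame.

Lemma frame_col A C A' C' S : frame A C A' C' -> vert S ->
  ~~ (A :\: C \subset S) -> ~~ (C :\: A \subset S) -> col S = col A'.
Proof.
move=> F; have [_ _ d3 cC'] := frame_ends F.
move eqN: #|(A :&: C) :\: S| => N; elim/ltn_ind: N S eqN => N IH S eqN vS nAS nCS.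
have IHS Y : vert Y -> #|(A :&: C) :\: Y| < N ->
    ~~ (A :\: C \subset Y) -> ~~ (C :\: A \subset Y) -> col Y = col A'.
  by move=> vY XY; apply: IH XY Y erefl vY.
apply: (ord3_third (t := col S) d3).
  by apply: (frame_col_neq F vS nAS nCS); rewrite eqN.
apply: (frame_col_neq (frame_sym F) vS nCS nAS) => Y vY.
by rewrite setIC eqN cC' => XY nCY nAY; apply: IHS.
Qed.

Lemma min_path_frame v : gpath le n v r ->
  distinct3 (col (v 0)) (col (v 1)) (col (v r)) ->
  (forall t, 0 < t < r -> col (v t) = col (v 1)) ->
  [set: T] = \bigcup_(i < r.+1) v i -> 2 < #|v 0 :\: v r| ->
  frame (v 0) (v r) (v 1) (v r.-1).
Proof.
move=> vpath d3 inner cover m3; have [vv adjv _] := vpath.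
have mr : #|v 0 :\: v r| <= r by have := gpath_cardsD vpath (leq0n r) (leqnn r); rewrite subn0.
have r3 : 2 < r := leq_trans m3 mr.
have vr1 : (r.-1).+1 = r by rewrite prednK // ltnW // ltnW.
have E : ends (v 0) (v r) (v 1) (v r.-1).
  split=> //; first by split; apply: vv; lia.
  - by split; [apply/gadj_sym/adjv | rewrite -{2}vr1; apply: adjv]; lia.
  - by apply: inner; lia.
have rm : #|v 0 :\: v r| = r by apply/eqP; rewrite eqn_leq mr (ends_card_ge E).
have between t : t <= r -> v 0 :&: v r \subset v t /\ v t \subset v 0 :|: v r.
  move=> tr; apply: geodesic_interval (vv 0 _) (vv t tr) (vv r _) _ => //.
  have := gpath_cardsD vpath (leq0n t) tr; have := gpath_cardsD vpath tr (leqnn r).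
  by rewrite rm; lia.
split=> //.
- by rewrite subsetI (between 1 _).1 ?(between r.-1 _).1 //; lia.
- by move=> r3'; rewrite r3' /=; apply: adjv; rewrite r3'.
- move=> x; have : x \in [set: T] by [].
  rewrite cover => /bigcupP[i _ xi].
  by apply: subsetP (between i _).2 _ xi; rewrite -ltnS.
Qed.

End MinimalSpecialPath.

Theorem mainTheorem15
  (T : finType) (le : rel T) (n : nat) (G : 'I_3 -> rel 'I_n)
  (v : nat -> {set T}) (r : nat) :
  partial_order le ->
  (forall t, partial_order (G t)) ->
  (forall s t : 'I_3, s != t -> ~ poset_iso (G s) (G t)) ->
  witness le G ->
  special_path_idx le G ord0 (inord 1) (inord 2) v r ->
  (forall (w : nat -> {set T}) (k : nat), special_path le G w k -> r <= k) ->
  [set: T] = \bigcup_(i < r.+1) v i ->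
  3 <= #|v 0 :\: (v 0 :&: v r)| ->
  forall S : {set T}, gvertex le n S ->
    ~~ (v 0 :\: (v 0 :&: v r) \subset S) ->
    ~~ (v r :\: (v 0 :&: v r) \subset S) ->
    iso_to le S (G (inord 1)).
Proof.
move=> le_order _ G_distinct G_witness [[r2 vpath idx] isoA isoB isoC] r_min cover.
rewrite setDIr setDv set0U => m3 S vS nA; rewrite setDIr setDv setU0 => nC.
have col_v t : 0 < t < r -> col le G (v t) = inord 1 := fun tr => col_eq G_distinct (isoB t tr).
have d3 : distinct3 (col le G (v 0)) (col le G (v 1)) (col le G (v r)).
  rewrite (col_eq G_distinct isoA) (col_eq G_distinct isoC) col_v; first exact/and3P.
  by rewrite r2.
have inner t : 0 < t < r -> col le G (v t) = col le G (v 1) by move=> tr; rewrite !col_v //; lia.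
have F := min_path_frame le_order G_witness r_min vpath d3 inner cover m3.
rewrite -(col_v 1); last by lia.
rewrite -(frame_col le_order G_witness r_min F vS nA nC).
exact: (colP G_witness vS).
Qed.
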